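(* Let $X$ be a non-empty set. The map $M^{\lambda}(X^*,X\cup\overline{X})/\rho_p\to\mathsf{Perf}(X)$, $[(\Gamma,s)]_{\rho_p}\mapsto(\tilde{\Gamma},s)$, is an $X$-canonical $(\cdot,{}^+,{}^{\mathfrak{m}},\lambda)$-isomorphism. It follows that $\mathsf{Perf}(X)$ is $X$-canonically $(\cdot,{}^+,{}^{\mathfrak{m}},\lambda)$-isomorphic to $\mathsf{FFR}_p(X)$.
   Context: A restriction semigroup is an algebra $(R;\cdot,{}^+)$ of type $(2,1)$ such that $(R;\cdot)$ is a semigroup and the identities $x^+x=x$, $x^+y^+=y^+x^+$, $(x^+y)^+=x^+y^+$, $xy^+=(xy)^+x$ hold. Its set of projections is $P(R)=\{s^+ : s\in R\}$. The natural partial order is $s\le t$ iff $s=et$ for some $e\in P(R)$. The congruence $\sigma$ is the minimum congruence identifying all projections: $s\mathrel{\sigma}t$ iff $es=et$ for some $e\in P(R)$. An $F$-restriction semigroup is a restriction semigroup in which every $\sigma$-class has a maximum element with respect to $\le$; the maximum element of the $\sigma$-class of $s$ is denoted $s^{\mathfrak{m}}$. It has a maximum projection, denoted $\lambda$, which is its unique left identity. It is perfect if $s^{\mathfrak{m}}t^{\mathfrak{m}}=(st)^{\mathfrak{m}}$ and $(s^{\mathfrak{m}})^+=\lambda$ for all $s,t$; a perfect $F$-restriction semigroup is a monoid with identity $\lambda$. Perfect $F$-restriction monoids, regarded as algebras in the signature $(\cdot,{}^+,{}^{\mathfrak{m}},\lambda)$ of type $(2,1,1,0)$, form a variety, and $\mathsf{FFR}_p(X)$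 denotes its free $X$-generated object. A morphism of $X$-generated algebras is $X$-canonical if it commutes with the assignment maps from $X$. $X^*$ is the free monoid on $X$ with identity $\lambda$, and $\overline{X}=\{\overline{x}:x\in X\}$ is a disjoint bijective copy of $X$. The Cayley graph $\mathrm{Cay}(X^*,X\cup\overline{X})$ has vertex set $X^*$ and labeled directed edges $(w,x,wx)$ and $(w,\overline{x},wx)$ for $w\in X^*$, $x\in X$; $\mathrm{Cay}(X^*,X)$ is its subgraph with all vertices and the edges labeled by $X$. A subgraph is accessible if it contains the vertex $\lambda$ and each of its vertices is reachable by a directed path in the subgraph from $\lambda$. $M^{\lambda}(X^*,X\cup\overline{X})$ is the restriction monoid of all pairs $(\Gamma,s)$ where $\Gamma$ is a finite accessible subgraph of $\mathrm{Cay}(X^*,X\cup\overline{X})$ (including the graph with only the vertex $\lambda$ and no edges) and $s$ is a vertex of $\Gamma$, with $(A,s)(B,t)=(A\cup sB,st)$ and $(A,s)^+=(A,\lambda)$, where $sB$ is the left translate of $B$ by $s$. It is $(X\cup\overline{X})$-generated as a restriction monoid via $y\mapsto(\Gamma_y,[y])$, where $\Gamma_y$ consists of the single edge labeled $y$ starting at $\lambda$ and its endpoints, and $[x]=[\overline{x}]=x$. $\mathsf{FFR}_p(X)$ is $(X\cup\overline{X})$-generated as a restriction monoid via $x\mapsto x$, $\overline{x}\mapsto x^{\mathfrak{m}}$, and it is an $(X\cup\overline{X})$-canonical quotient of $M^{\lambda}(X^*,X\cup\overline{X})$; $\rho_p$ is the kernel congruence of this canonical quotient morphism, so that $M^{\lambda}(X^*,X\cup\overline{X})/\rho_p$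 is canonically isomorphic to $\mathsf{FFR}_p(X)$. The $\rho_p$-class of $(\Gamma,s)$ is denoted $[(\Gamma,s)]_{\rho_p}$. For a subgraph $\Gamma$ of $\mathrm{Cay}(X^*,X\cup\overline{X})$, $\tilde{\Gamma}$ is the subgraph of $\mathrm{Cay}(X^*,X)$ induced by the edges of $\Gamma$ labeled by elements of $X$ (those edges together with their endpoints). $\overline{\mathcal{X}}_X$ is the set of all finite, not necessarily connected, subgraphs of $\mathrm{Cay}(X^*,X)$ without isolated vertices (including the empty subgraph $\varnothing$). $\mathsf{Perf}(X)=\{(\Gamma,s):\Gamma\in\overline{\mathcal{X}}_X,\ s\in X^*\}$ with the operations $(A,s)(B,t)=(A\cup sB,st)$, $(A,s)^+=(A,\lambda)$, $(A,s)^{\mathfrak{m}}=(\varnothing,s)$ and the identity element $(\varnothing,\lambda)$; it is considered with the assignment map $x\mapsto(\Gamma_x,x)$, $x\in X$. *)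

(* Defs.v *)
From HB Require Import structures.
From mathcomp Require Import all_boot.
From mathcomp Require Import boolp classical_sets functions cardinality.

Set Implicit Arguments.
Unset Strict Implicit.
Unset Printing Implicit Defensive.

Local Open Scope classical_set_scope.

Record equivalence_on (T : Type) (r : T -> T -> Prop) : Prop := EquivalenceOn {
  eqv_refl : forall x, r x x;
  eqv_sym : forall x y, r x y -> r y x;
  eqv_trans : forall x y z, r x y -> r y z -> r x z }.

Lemma bool_refl (T : Type) (r : T -> T -> Prop) (E : equivalence_on r) :
  reflexive (fun x y : {classic T} => `[< r x y >]).
Proof. by move=> x; apply/asboolP; apply: (eqv_refl E). Qed.

Lemma bool_sym (T : Type) (r : T -> T -> Prop) (E : equivalence_on r) :
  symmetric (fun x y : {classic T} => `[< r x y >]).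
Proof. by move=> x y; apply/asboolP/asboolP; apply: (eqv_sym E). Qed.

Lemma bool_trans (T : Type) (r : T -> T -> Prop) (E : equivalence_on r) :
  transitive (fun x y : {classic T} => `[< r x y >]).
Proof.
by move=> y x z /asboolP xy /asboolP yz; apply/asboolP; apply: (eqv_trans E) yz.
Qed.

Definition bool_equiv (T : Type) (r : T -> T -> Prop) (E : equivalence_on r) :=
  EquivRel (fun x y : {classic T} => `[< r x y >])
    (bool_refl E) (bool_sym E) (bool_trans E).

Definition quot (T : Type) (r : T -> T -> Prop) (E : equivalence_on r) : Type :=
  {eq_quot (bool_equiv E)}%qT.

Definition cls (T : Type) (r : T -> T -> Prop) (E : equivalence_on r) (x : T) :
  quot E := (\pi_({eq_quot (bool_equiv E)}) (x : {classic T}))%qT.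

Definition rep (T : Type) (r : T -> T -> Prop) (E : equivalence_on r)
  (c : quot E) : T := @generic_quotient.repr {classic T} {eq_quot (bool_equiv E)}%qT c.

Lemma repK (T : Type) (r : T -> T -> Prop) (E : equivalence_on r) (c : quot E) :
  cls E (rep c) = c.
Proof. exact: (@reprK {classic T} {eq_quot (bool_equiv E)}%qT). Qed.

Lemma clsP (T : Type) (r : T -> T -> Prop) (E : equivalence_on r) (x y : T) :
  cls E x = cls E y <-> r x y.
Proof.
split=> [/(@eqmodP _ (bool_equiv E) x y)/asboolP //|rxy].
by apply/(@eqmodP _ (bool_equiv E) x y)/asboolP.
Qed.

Lemma rep_cls (T : Type) (r : T -> T -> Prop) (E : equivalence_on r) (x : T) :
  r (rep (cls E x)) x.
Proof. by apply/(clsP E); rewrite repK. Qed.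

Record restrictionSemigroup := RestrictionSemigroup {
  rs_sort :> Type;
  rmul : rs_sort -> rs_sort -> rs_sort;
  rplus : rs_sort -> rs_sort;
  rmulA : forall x y z, rmul x (rmul y z) = rmul (rmul x y) z;
  rplus_mul : forall x, rmul (rplus x) x = x;
  rplusC : forall x y, rmul (rplus x) (rplus y) = rmul (rplus y) (rplus x);
  rplus_plusM : forall x y, rplus (rmul (rplus x) y) = rmul (rplus x) (rplus y);
  rmul_plus : forall x y, rmul x (rplus y) = rmul (rplus (rmul x y)) x }.

Arguments rmul {_} _ _.
Arguments rplus {_} _.

Definition projection (R : restrictionSemigroup) (e : R) : Prop :=
  exists s : R, e = rplus s.

Definition nle (R : restrictionSemigroup) (s t : R) : Prop :=
  exists2 e : R, projection e & s = rmul e t.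

(* The minimum congruence that identifies all projections. *)
Definition sigma (R : restrictionSemigroup) (s t : R) : Prop :=
  exists2 e : R, projection e & rmul e s = rmul e t.

Definition is_sigma_max (R : restrictionSemigroup) (s m : R) : Prop :=
  sigma s m /\ forall t : R, sigma s t -> nle t m.

(* [pmax s] is the maximum of the sigma-class of [s] and [pone] is the maximum
   projection; that [pone] is a two-sided identity is derived below ([pmul1],
   [pmulr1]). *)
Record perfectFRestriction := PerfectFRestriction {
  pf_rs :> restrictionSemigroup;
  pmax : pf_rs -> pf_rs;
  pone : pf_rs;
  pmaxP : forall s, is_sigma_max s (pmax s);
  pone_proj : projection pone;
  pone_max : forall e : pf_rs, projection e -> nle e pone;
  pmaxM : forall s t, rmul (pmax s) (pmax t) = pmax (rmul s t);
  pmax_plus : forall s, rplus (pmax s) = pone }.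

Arguments pmax {_} _.
Arguments pone {_}.

Definition pf_morphism (F G : perfectFRestriction) (f : F -> G) : Prop :=
  [/\ forall s t, f (rmul s t) = rmul (f s) (f t),
      forall s, f (rplus s) = rplus (f s),
      forall s, f (pmax s) = pmax (f s) &
      f pone = pone].

Definition canonical_iso (X : Type) (F G : perfectFRestriction)
    (i : X -> F) (j : X -> G) (f : F -> G) : Prop :=
  [/\ pf_morphism f, bijective f & forall x, f (i x) = j x].

Lemma projM (R : restrictionSemigroup) (e f : R) :
  projection e -> projection f -> projection (rmul e f).
Proof.
by move=> [s ->] [t ->]; exists (rmul (rplus s) t); rewrite rplus_plusM.
Qed.

Lemma projC (R : restrictionSemigroup) (e f : R) :
  projection e -> projection f -> rmul e f = rmul f e.
Proof. by move=> [s ->] [t ->]; rewrite rplusC. Qed.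

Lemma proj_idem (R : restrictionSemigroup) (e : R) :
  projection e -> rmul e e = e.
Proof. by move=> [s ->]; rewrite -rplus_plusM rplus_mul. Qed.

Lemma proj_plus (R : restrictionSemigroup) (e : R) : projection e -> rplus e = e.
Proof.
move=> [s ->]; have pp := proj_idem (ex_intro _ s erefl : projection (rplus s)).
by rewrite -{1}pp rplus_plusM rplusC rplus_mul.
Qed.

Lemma proj_plusM (R : restrictionSemigroup) (e s : R) :
  projection e -> rplus (rmul e s) = rmul e (rplus s).
Proof. by move=> [t ->]; rewrite rplus_plusM. Qed.

Lemma sigma_sym (R : restrictionSemigroup) (s t : R) : sigma s t -> sigma t s.
Proof. by move=> [e pe est]; exists e. Qed.

Lemma sigma_trans (R : restrictionSemigroup) (s t u : R) :
  sigma s t -> sigma t u -> sigma s u.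
Proof.
move=> [e pe est] [f pf ftu]; exists (rmul f e); first exact: projM.
by rewrite -!rmulA est !rmulA (projC pf pe) -!rmulA ftu.
Qed.

Lemma nle_antisym (R : restrictionSemigroup) (s t : R) : nle s t -> nle t s -> s = t.
Proof.
move=> [e pe es] [f pf ft].
have et : t = rmul f t by rewrite {2}ft rmulA (proj_idem pf).
rewrite {1}es {1}et rmulA (projC pe pf) -rmulA -es; exact/esym.
Qed.

Lemma pone_projection (F : perfectFRestriction) : projection (pone : F).
Proof. exact: pone_proj. Qed.

Lemma pmul1 (F : perfectFRestriction) (x : F) : rmul pone x = x.
Proof.
have px : projection (rplus x) by exists x.
have [e pe ex] := pone_max px.
have ep : rmul pone (rplus x) = rplus x.
  by rewrite (projC (pone_projection F) px) {1}ex -rmulA (proj_idem (pone_projection F)) -ex.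
by rewrite -{1}(rplus_mul x) rmulA ep rplus_mul.
Qed.

Lemma pmax_eq (F : perfectFRestriction) (s t : F) : sigma s t -> pmax s = pmax t.
Proof.
move=> st; have [sm sM] := pmaxP s; have [tm tM] := pmaxP t.
apply: nle_antisym; first by apply: tM; exact: sigma_trans (sigma_sym st) sm.
by apply: sM; exact: sigma_trans st tm.
Qed.

Lemma pmax1 (F : perfectFRestriction) : pmax pone = pone :> F.
Proof.
have [_ /(_ pone)[|e pe e1]] := pmaxP (pone : F).
  by exists pone => //; exact: pone_projection.
have := proj_plusM (pmax pone) pe.
rewrite -e1 (proj_plus (pone_projection F)) pmax_plus (projC pe (pone_projection F)) pmul1 => e1'.
by rewrite [RHS]e1 -e1' pmul1.
Qed.

Lemma pmax_proj (F : perfectFRestriction) (e : F) : projection e -> pmax e = pone.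
Proof.
move=> pe; rewrite -[RHS]pmax1; apply: pmax_eq; exists e => //.
by rewrite (proj_idem pe) (projC pe (pone_projection F)) pmul1.
Qed.

Lemma pmax_projM (F : perfectFRestriction) (e s : F) :
  projection e -> pmax (rmul e s) = pmax s.
Proof.
by move=> pe; apply: pmax_eq; exists e => //; rewrite rmulA (proj_idem pe).
Qed.

Lemma plus_max (F : perfectFRestriction) (s : F) : rmul (rplus s) (pmax s) = s.
Proof.
have [_ /(_ s)[|e pe es]] := pmaxP s; first by exists pone => //; exact: pone_projection.
by rewrite {1}es (proj_plusM _ pe) pmax_plus (projC pe (pone_projection F)) pmul1 -es.
Qed.

Lemma pmulr1 (F : perfectFRestriction) (x : F) : rmul x pone = x.
Proof.
rewrite -{1}(plus_max x) -rmulA -{1}pmax1 pmaxM -{1}(proj_plus (pone_projection F)).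
by rewrite rmul_plus pmax_projM ?plus_max //; exists (rmul x pone).
Qed.

Inductive term (X : Type) : Type :=
| Var of X
| TMul of term X & term X
| TPlus of term X
| TMax of term X
| TOne.

Arguments TOne {X}.

Fixpoint eval (X : Type) (F : perfectFRestriction) (f : X -> F) (t : term X) : F :=
  match t with
  | Var x => f x
  | TMul t u => rmul (eval f t) (eval f u)
  | TPlus t => rplus (eval f t)
  | TMax t => pmax (eval f t)
  | TOne => pone
  end.

(* The free object is the term algebra modulo the identities valid in all perfect
   F-restriction monoids; [FFRp_free] is its universal property. *)
Definition identity_holds (X : Type) (t u : term X) : Prop :=
  forall (F : perfectFRestriction) (f : X -> F), eval f t = eval f u.

Lemma identity_equiv (X : Type) : equivalence_on (@identity_holds X).
Proof.
by split=> [t F f|t u tu F f|t u v tu uv F f] //; rewrite tu.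
Qed.

Definition free_sort (X : Type) : Type := quot (identity_equiv X).

Definition tcls (X : Type) (t : term X) : free_sort X := cls (identity_equiv X) t.

Definition free_mul (X : Type) (a b : free_sort X) : free_sort X :=
  tcls (TMul (rep a) (rep b)).
Definition free_plus (X : Type) (a : free_sort X) : free_sort X :=
  tcls (TPlus (rep a)).
Definition free_max (X : Type) (a : free_sort X) : free_sort X :=
  tcls (TMax (rep a)).
Definition free_one (X : Type) : free_sort X := tcls TOne.

Lemma tclsP (X : Type) (t u : term X) : tcls t = tcls u <-> identity_holds t u.
Proof. exact: clsP. Qed.

Lemma tcls_ind (X : Type) (P : free_sort X -> Prop) :
  (forall t, P (tcls t)) -> forall a, P a.
Proof. by move=> Pt a; rewrite -(repK a); exact: Pt. Qed.

Lemma eval_rep (X : Type) (t : term X) (F : perfectFRestriction) (f : X -> F) :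
  eval f (rep (tcls t)) = eval f t.
Proof. exact: (rep_cls (identity_equiv X)). Qed.

Lemma free_mulE (X : Type) (t u : term X) :
  free_mul (tcls t) (tcls u) = tcls (TMul t u).
Proof. by apply/tclsP => F f /=; rewrite !eval_rep. Qed.

Lemma free_plusE (X : Type) (t : term X) : free_plus (tcls t) = tcls (TPlus t).
Proof. by apply/tclsP => F f /=; rewrite !eval_rep. Qed.

Lemma free_maxE (X : Type) (t : term X) : free_max (tcls t) = tcls (TMax t).
Proof. by apply/tclsP => F f /=; rewrite !eval_rep. Qed.

Lemma free_mulA (X : Type) (x y z : free_sort X) :
  free_mul x (free_mul y z) = free_mul (free_mul x y) z.
Proof.
elim/tcls_ind: x => t; elim/tcls_ind: y => u; elim/tcls_ind: z => v.
by rewrite !free_mulE; apply/tclsP => F f; exact: rmulA.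
Qed.

Lemma free_plus_mul (X : Type) (x : free_sort X) : free_mul (free_plus x) x = x.
Proof.
elim/tcls_ind: x => t.
by rewrite free_plusE free_mulE; apply/tclsP => F f; exact: rplus_mul.
Qed.

Lemma free_plusC (X : Type) (x y : free_sort X) :
  free_mul (free_plus x) (free_plus y) = free_mul (free_plus y) (free_plus x).
Proof.
elim/tcls_ind: x => t; elim/tcls_ind: y => u.
by rewrite !free_plusE !free_mulE; apply/tclsP => F f; exact: rplusC.
Qed.

Lemma free_plus_plusM (X : Type) (x y : free_sort X) :
  free_plus (free_mul (free_plus x) y) = free_mul (free_plus x) (free_plus y).
Proof.
by apply/tclsP => F f; rewrite /= !eval_rep /= !eval_rep rplus_plusM.
Qed.

Lemma free_mul_plus (X : Type) (x y : free_sort X) :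
  free_mul x (free_plus y) = free_mul (free_plus (free_mul x y)) x.
Proof.
by apply/tclsP => F f; rewrite /= !eval_rep /= !eval_rep rmul_plus.
Qed.

Definition free_rs (X : Type) : restrictionSemigroup :=
  @RestrictionSemigroup (free_sort X) (@free_mul X) (@free_plus X)
    (@free_mulA X) (@free_plus_mul X) (@free_plusC X) (@free_plus_plusM X)
    (@free_mul_plus X).

Lemma fr_mulE (X : Type) (t u : term X) :
  rmul (tcls t : free_rs X) (tcls u : free_rs X) = tcls (TMul t u).
Proof. exact: free_mulE. Qed.

Lemma fr_plusE (X : Type) (t : term X) :
  rplus (tcls t : free_rs X) = tcls (TPlus t).
Proof. exact: free_plusE. Qed.

Lemma free_proj (X : Type) (e : free_rs X) :
  projection e -> exists t : term X, e = tcls (TPlus t).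
Proof. by move=> [s ->]; elim/tcls_ind: s => t; exists t; exact: free_plusE. Qed.

Lemma free_maxP (X : Type) (s : free_rs X) : is_sigma_max s (free_max s : free_rs X).
Proof.
elim/tcls_ind: s => t; rewrite free_maxE; split.
  exists (tcls (TPlus t)); first by exists (tcls t); rewrite [RHS]fr_plusE.
  rewrite [LHS]fr_mulE [RHS]fr_mulE; apply/tclsP => F f /=.
  by rewrite rplus_mul plus_max.
elim/tcls_ind => u [e /free_proj[v ->]].
rewrite [LHS]fr_mulE [RHS]fr_mulE => /tclsP vtu.
exists (tcls (TPlus u)); first by exists (tcls u); rewrite [RHS]fr_plusE.
rewrite [RHS]fr_mulE; apply/tclsP => F f /=.
have := congr1 pmax (vtu F f); rewrite /= !pmax_projM; try by eexists.
by move=> ->; rewrite plus_max.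
Qed.

Lemma free_one_proj (X : Type) : projection (free_one X : free_rs X).
Proof.
exists (free_one X); rewrite [RHS]fr_plusE; apply/tclsP => F f /=.
by rewrite (proj_plus (pone_projection F)).
Qed.

Lemma free_one_max (X : Type) (e : free_rs X) :
  projection e -> nle e (free_one X : free_rs X).
Proof.
move=> pe; exists e => //; have [t ->] := free_proj pe.
by rewrite [RHS]fr_mulE; apply/tclsP => F f /=; rewrite pmulr1.
Qed.

Lemma free_maxM (X : Type) (s t : free_rs X) :
  rmul (free_max s : free_rs X) (free_max t : free_rs X) = free_max (rmul s t).
Proof.
elim/tcls_ind: s => t'; elim/tcls_ind: t => u.
rewrite !free_maxE fr_mulE.
by apply/tclsP => F f /=; rewrite !eval_rep pmaxM.
Qed.

Lemma free_max_plus (X : Type) (s : free_rs X) :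
  rplus (free_max s : free_rs X) = free_one X.
Proof.
elim/tcls_ind: s => t; rewrite free_maxE [LHS]fr_plusE.
by apply/tclsP => F f /=; rewrite pmax_plus.
Qed.

Definition FFRp (X : Type) : perfectFRestriction :=
  @PerfectFRestriction (free_rs X) (@free_max X) (free_one X)
    (@free_maxP X) (@free_one_proj X) (@free_one_max X) (@free_maxM X)
    (@free_max_plus X).

Definition FFRp_gen (X : Type) (x : X) : FFRp X := tcls (Var x).

Theorem FFRp_free (X : Type) (F : perfectFRestriction) (f : X -> F) :
  exists! h : FFRp X -> F, pf_morphism h /\ forall x, h (FFRp_gen x) = f x.
Proof.
exists (fun a => eval f (rep a)); split.
  split=> [|x]; last exact: eval_rep.
  split=> [s t|s|s|]; exact: eval_rep.
move=> h [[hM hp hm h1] hx]; apply/funext; elim/tcls_ind => t.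
rewrite eval_rep; elim: t => [x|t IHt u IHu|t IHt|t IHt|] /=.
- by rewrite -hx.
- by rewrite IHt IHu -hM; congr h; exact: fr_mulE.
- by rewrite IHt -hp; congr h; exact: fr_plusE.
- by rewrite IHt -hm; congr h; exact: free_maxE.
- by rewrite -h1.
Qed.

(* [subgraph lab] is the type of subgraphs of Cay(X^*, Y), where a letter [y : Y]
   has value [lab y : X]; the pair [(w, y)] encodes the edge (w, y, w (lab y)). *)
Record subgraph (X Y : Type) (lab : Y -> X) := Subgraph {
  vertex : set (seq X);
  edge : set (seq X * Y);
  edge_src : forall w y, edge (w, y) -> vertex w;
  edge_tgt : forall w y, edge (w, y) -> vertex (rcons w (lab y)) }.

Lemma subgraph_eq (X Y : Type) (lab : Y -> X) (A B : subgraph lab) :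
  vertex A = vertex B -> edge A = edge B -> A = B.
Proof.
case: A B => [V E s t] [V' E' s' t'] /= eV eE; subst V' E'.
by congr Subgraph; apply: Prop_irrelevance.
Qed.

Definition finite_subgraph (X Y : Type) (lab : Y -> X) (A : subgraph lab) : Prop :=
  finite_set (vertex A) /\ finite_set (edge A).

Inductive reachable (X Y : Type) (lab : Y -> X) (A : subgraph lab) (u : seq X) :
  seq X -> Prop :=
| reach_refl : reachable A u u
| reach_step w y : reachable A u w -> edge A (w, y) ->
    reachable A u (rcons w (lab y)).

Definition accessible (X Y : Type) (lab : Y -> X) (A : subgraph lab) : Prop :=
  vertex A [::] /\ forall v, vertex A v -> reachable A [::] v.

#[local] Obligation Tactic := idtac.

Program Definition gunion (X Y : Type) (lab : Y -> X) (A B : subgraph lab) :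
  subgraph lab :=
  @Subgraph _ _ lab (vertex A `|` vertex B) (edge A `|` edge B) _ _.
Next Obligation.
by move=> X Y lab A B w y [] e; [left|right]; exact: edge_src e.
Qed.
Next Obligation.
by move=> X Y lab A B w y [] e; [left|right]; exact: edge_tgt e.
Qed.

Program Definition gtranslate (X Y : Type) (lab : Y -> X) (s : seq X)
  (B : subgraph lab) : subgraph lab :=
  @Subgraph _ _ lab [set s ++ v | v in vertex B]
    [set (s ++ e.1, e.2) | e in edge B] _ _.
Next Obligation.
move=> X Y lab s B w y [[v z] /= Bv [<- _]].
by exists v => //; exact: edge_src Bv.
Qed.
Next Obligation.
move=> X Y lab s B w y [[v z] /= Bv [<- <-]].
by exists (rcons v (lab z)); [exact: edge_tgt Bv|rewrite rcons_cat].
Qed.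

Program Definition gpoint (X Y : Type) (lab : Y -> X) : subgraph lab :=
  @Subgraph _ _ lab [set [::]] set0 _ _.
Next Obligation. by []. Qed.
Next Obligation. by []. Qed.

Program Definition gempty (X Y : Type) (lab : Y -> X) : subgraph lab :=
  @Subgraph _ _ lab set0 set0 _ _.
Next Obligation. by []. Qed.
Next Obligation. by []. Qed.

Program Definition gletter (X Y : Type) (lab : Y -> X) (y : Y) : subgraph lab :=
  @Subgraph _ _ lab [set v | v = [::] \/ v = [:: lab y]] [set ([::], y)] _ _.
Next Obligation. by move=> X Y lab y w z [-> _]; left. Qed.
Next Obligation. by move=> X Y lab y w z [-> ->]; right. Qed.

Lemma gunionA (X Y : Type) (lab : Y -> X) (A B C : subgraph lab) :
  gunion A (gunion B C) = gunion (gunion A B) C.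
Proof. by apply: subgraph_eq; exact: setUA. Qed.

Lemma gunionC (X Y : Type) (lab : Y -> X) (A B : subgraph lab) :
  gunion A B = gunion B A.
Proof. by apply: subgraph_eq; exact: setUC. Qed.

Lemma gunionid (X Y : Type) (lab : Y -> X) (A : subgraph lab) : gunion A A = A.
Proof. by apply: subgraph_eq; exact: setUid. Qed.

Lemma gunion0 (X Y : Type) (lab : Y -> X) (A : subgraph lab) :
  gunion A (gempty lab) = A.
Proof. by apply: subgraph_eq; exact: setU0. Qed.

Lemma gtranslate0 (X Y : Type) (lab : Y -> X) (s : seq X) :
  gtranslate s (gempty lab) = gempty lab.
Proof. by apply: subgraph_eq; exact: image_set0. Qed.

Lemma gtranslateU (X Y : Type) (lab : Y -> X) (s : seq X) (A B : subgraph lab) :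
  gtranslate s (gunion A B) = gunion (gtranslate s A) (gtranslate s B).
Proof. by apply: subgraph_eq; exact: image_setU. Qed.

Lemma gtranslate_nil (X Y : Type) (lab : Y -> X) (A : subgraph lab) :
  gtranslate [::] A = A.
Proof.
apply: subgraph_eq => /=; first exact: image_id.
by apply/seteqP; split=> [_ [[v y] Av <-]|[v y] Av] //; exists (v, y).
Qed.

Lemma gtranslateM (X Y : Type) (lab : Y -> X) (s t : seq X) (A : subgraph lab) :
  gtranslate s (gtranslate t A) = gtranslate (s ++ t) A.
Proof.
apply: subgraph_eq => /=; rewrite image_comp; apply: eq_imagel => v _ /=;
  by rewrite catA.
Qed.

Lemma gunion_finite (X Y : Type) (lab : Y -> X) (A B : subgraph lab) :
  finite_subgraph A -> finite_subgraph B -> finite_subgraph (gunion A B).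
Proof. by move=> [? ?] [? ?]; split; rewrite finite_setU. Qed.

Lemma gtranslate_finite (X Y : Type) (lab : Y -> X) (s : seq X) (A : subgraph lab) :
  finite_subgraph A -> finite_subgraph (gtranslate s A).
Proof. by move=> [? ?]; split; exact: finite_image. Qed.

Lemma gpoint_finite (X Y : Type) (lab : Y -> X) : finite_subgraph (gpoint lab).
Proof. by split; [exact: finite_set1|exact: finite_set0]. Qed.

Lemma gempty_finite (X Y : Type) (lab : Y -> X) : finite_subgraph (gempty lab).
Proof. by split; exact: finite_set0. Qed.

Lemma gletter_finite (X Y : Type) (lab : Y -> X) (y : Y) :
  finite_subgraph (gletter lab y).
Proof.
split=> /=; last exact: finite_set1.
by rewrite -[X in finite_set X]/([set [::]] `|` [set [:: lab y]]) finite_setU;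
  split; exact: finite_set1.
Qed.

Lemma reachable_trans (X Y : Type) (lab : Y -> X) (A : subgraph lab) u v w :
  reachable A u v -> reachable A v w -> reachable A u w.
Proof. by move=> uv; elim=> // w' y _ uw' Aw'; exact: reach_step. Qed.

Lemma reachable_sub (X Y : Type) (lab : Y -> X) (A B : subgraph lab) u v :
  edge A `<=` edge B -> reachable A u v -> reachable B u v.
Proof.
move=> AB; elim=> [|w y _ uw /AB Bw]; [exact: reach_refl|exact: reach_step].
Qed.

Lemma reachable_translate (X Y : Type) (lab : Y -> X) (s : seq X)
    (A : subgraph lab) u v :
  reachable A u v -> reachable (gtranslate s A) (s ++ u) (s ++ v).
Proof.
elim=> [|w y _ uw Aw]; first exact: reach_refl.
by rewrite -rcons_cat; apply: reach_step => //; exists (w, y).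
Qed.

Lemma gpoint_accessible (X Y : Type) (lab : Y -> X) : accessible (gpoint lab).
Proof. by split=> // v ->; exact: reach_refl. Qed.

Lemma gletter_accessible (X Y : Type) (lab : Y -> X) (y : Y) :
  accessible (gletter lab y).
Proof.
split=> [|v [->|->]]; [by left|exact: reach_refl|].
by apply: (@reach_step _ _ _ _ _ [::]) => //; exact: reach_refl.
Qed.

Lemma gmul_accessible (X Y : Type) (lab : Y -> X) (A B : subgraph lab) s :
  accessible A -> accessible B -> vertex A s ->
  accessible (gunion A (gtranslate s B)).
Proof.
move=> [A0 Ar] [B0 Br] As; split=> [|v [/Ar|[w /Br Bw <-]]]; first by left.
  by apply: reachable_sub => e; left.
apply: (@reachable_trans _ _ _ _ _ s).
  by apply: (reachable_sub _ (Ar _ As)) => e; left.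
have := reachable_translate s Bw; rewrite cats0 => sw.
by apply: (reachable_sub _ sw) => e; right.
Qed.

(* For [lab = unbar] below, [mm_sort lab] is M^lambda(X^*, X u \overline{X}). *)
Record mm_sort (X Y : Type) (lab : Y -> X) := MMElt {
  mm_graph : subgraph lab;
  mm_end : seq X;
  mm_finite : finite_subgraph mm_graph;
  mm_accessible : accessible mm_graph;
  mm_end_vertex : vertex mm_graph mm_end }.

Lemma mm_eq (X Y : Type) (lab : Y -> X) (a b : mm_sort lab) :
  mm_graph a = mm_graph b -> mm_end a = mm_end b -> a = b.
Proof.
case: a b => [A s ? ? ?] [B t ? ? ?] /= eA es; subst B t.
by congr MMElt; exact: Prop_irrelevance.
Qed.

Lemma gmul_vertex (X Y : Type) (lab : Y -> X) (A B : subgraph lab) s t :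
  vertex B t -> vertex (gunion A (gtranslate s B)) (s ++ t).
Proof. by move=> Bt; right; exists t. Qed.

Definition mm_mul (X Y : Type) (lab : Y -> X) (a b : mm_sort lab) : mm_sort lab :=
  @MMElt _ _ lab (gunion (mm_graph a) (gtranslate (mm_end a) (mm_graph b)))
    (mm_end a ++ mm_end b)
    (gunion_finite (mm_finite a) (gtranslate_finite (mm_end a) (mm_finite b)))
    (gmul_accessible (mm_accessible a) (mm_accessible b) (mm_end_vertex a))
    (gmul_vertex (mm_graph a) (mm_end a) (mm_end_vertex b)).

Definition mm_plus (X Y : Type) (lab : Y -> X) (a : mm_sort lab) : mm_sort lab :=
  @MMElt _ _ lab (mm_graph a) [::] (mm_finite a) (mm_accessible a)
    (proj1 (mm_accessible a)).

Definition mm_one (X Y : Type) (lab : Y -> X) : mm_sort lab :=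
  @MMElt _ _ lab (gpoint lab) [::] (gpoint_finite lab) (gpoint_accessible lab)
    (erefl _).

Lemma mm_mulA (X Y : Type) (lab : Y -> X) (a b c : mm_sort lab) :
  mm_mul a (mm_mul b c) = mm_mul (mm_mul a b) c.
Proof.
by apply: mm_eq => /=; rewrite ?catA // gtranslateU gtranslateM gunionA.
Qed.

Lemma mm_plus_mul (X Y : Type) (lab : Y -> X) (a : mm_sort lab) :
  mm_mul (mm_plus a) a = a.
Proof. by apply: mm_eq => //=; rewrite gtranslate_nil gunionid. Qed.

Lemma mm_plusC (X Y : Type) (lab : Y -> X) (a b : mm_sort lab) :
  mm_mul (mm_plus a) (mm_plus b) = mm_mul (mm_plus b) (mm_plus a).
Proof. by apply: mm_eq => //=; rewrite !gtranslate_nil gunionC. Qed.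

Lemma mm_plus_plusM (X Y : Type) (lab : Y -> X) (a b : mm_sort lab) :
  mm_plus (mm_mul (mm_plus a) b) = mm_mul (mm_plus a) (mm_plus b).
Proof. exact: mm_eq. Qed.

Lemma mm_mul_plus (X Y : Type) (lab : Y -> X) (a b : mm_sort lab) :
  mm_mul a (mm_plus b) = mm_mul (mm_plus (mm_mul a b)) a.
Proof.
apply: mm_eq => /=; last exact: cats0.
by rewrite gtranslate_nil (gunionC (mm_graph a)) -gunionA gunionid.
Qed.

Definition mm_rs (X Y : Type) (lab : Y -> X) : restrictionSemigroup :=
  @RestrictionSemigroup (mm_sort lab) (@mm_mul X Y lab) (@mm_plus X Y lab)
    (@mm_mulA X Y lab) (@mm_plus_mul X Y lab) (@mm_plusC X Y lab)
    (@mm_plus_plusM X Y lab) (@mm_mul_plus X Y lab).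

Lemma mm_mul1 (X Y : Type) (lab : Y -> X) (a : mm_rs lab) :
  rmul (mm_one lab : mm_rs lab) a = a.
Proof.
apply: mm_eq => //=; rewrite gtranslate_nil; apply: subgraph_eq => /=.
  by apply/setUidPr => _ ->; have [] := mm_accessible a.
exact: set0U.
Qed.

Lemma mm_mulr1 (X Y : Type) (lab : Y -> X) (a : mm_rs lab) :
  rmul a (mm_one lab : mm_rs lab) = a.
Proof.
apply: mm_eq => /=; last exact: cats0.
apply: subgraph_eq => /=; last by rewrite image_set0 setU0.
by rewrite image_set1 cats0; apply/setUidPl => _ ->; exact: mm_end_vertex.
Qed.

Definition mm_gen (X Y : Type) (lab : Y -> X) (y : Y) : mm_rs lab :=
  @MMElt _ _ lab (gletter lab y) [:: lab y] (gletter_finite lab y)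
    (gletter_accessible lab y) (or_intror erefl).

(* [inl x] stands for the letter x and [inr x] for its copy \overline{x}. *)
Definition unbar (X : Type) (y : X + X) : X :=
  match y with inl x => x | inr x => x end.

Definition MX (X : Type) : restrictionSemigroup := mm_rs (@unbar X).
Definition MX_one (X : Type) : MX X := mm_one (@unbar X).
Definition MX_gen (X : Type) (y : X + X) : MX X := mm_gen (@unbar X) y.

Program Definition tilde (X : Type) (A : subgraph (@unbar X)) :
  subgraph (@idfun X) :=
  @Subgraph X X idfun
    [set v | exists w x, edge A (w, inl x) /\ (v = w \/ v = rcons w x)]
    [set e | edge A (e.1, inl e.2)] _ _.
Next Obligation. by move=> X A w x Ae; exists w, x; split=> //; left. Qed.
Next Obligation. by move=> X A w x Ae; exists w, x; split=> //; right. Qed.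

Lemma tilde_edge_finite (X : Type) (A : subgraph (@unbar X)) :
  finite_subgraph A -> finite_set [set e | edge A (e.1, inl e.2)].
Proof.
move=> [_ fE]; apply: sub_finite_set (finite_image (fun e => (e.1, unbar e.2)) fE).
by move=> [w x] Ae; exists (w, inl x).
Qed.

Definition no_isolated_vertex (X Y : Type) (lab : Y -> X) (A : subgraph lab) : Prop :=
  forall v, vertex A v ->
    exists w y, edge A (w, y) /\ (v = w \/ v = rcons w (lab y)).

Record perf_sort (X : Type) := PerfElt {
  perf_graph : subgraph (@idfun X);
  perf_elt : seq X;
  perf_finite : finite_subgraph perf_graph;
  perf_no_isolated : no_isolated_vertex perf_graph }.

Lemma perf_eq (X : Type) (a b : perf_sort X) :
  perf_graph a = perf_graph b -> perf_elt a = perf_elt b -> a = b.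
Proof.
case: a b => [A s ? ?] [B t ? ?] /= eA es; subst B t.
by congr PerfElt; exact: Prop_irrelevance.
Qed.

Lemma gempty_no_isolated (X Y : Type) (lab : Y -> X) :
  no_isolated_vertex (gempty lab).
Proof. by []. Qed.

Lemma gletter_no_isolated (X Y : Type) (lab : Y -> X) (y : Y) :
  no_isolated_vertex (gletter lab y).
Proof. by move=> v Av; exists [::], y. Qed.

Lemma gmul_no_isolated (X Y : Type) (lab : Y -> X) (A B : subgraph lab) s :
  no_isolated_vertex A -> no_isolated_vertex B ->
  no_isolated_vertex (gunion A (gtranslate s B)).
Proof.
move=> iA iB v [/iA[w [y [Ae wy]]]|[u /iB[w [y [Be wy]]] <-]].
  by exists w, y; split=> //; left.
exists (s ++ w), y; split; first by right; exists (w, y).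
by case: wy => ->; [left|right; rewrite rcons_cat].
Qed.

Definition perf_mul (X : Type) (a b : perf_sort X) : perf_sort X :=
  @PerfElt X (gunion (perf_graph a) (gtranslate (perf_elt a) (perf_graph b)))
    (perf_elt a ++ perf_elt b)
    (gunion_finite (perf_finite a) (gtranslate_finite (perf_elt a) (perf_finite b)))
    (gmul_no_isolated (s := perf_elt a) (@perf_no_isolated X a) (@perf_no_isolated X b)).

Definition perf_plus (X : Type) (a : perf_sort X) : perf_sort X :=
  @PerfElt X (perf_graph a) [::] (perf_finite a) (@perf_no_isolated X a).

Definition perf_max (X : Type) (a : perf_sort X) : perf_sort X :=
  @PerfElt X (gempty idfun) (perf_elt a) (gempty_finite idfun)
    (@gempty_no_isolated X X idfun).

Definition perf_one (X : Type) : perf_sort X :=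
  @PerfElt X (gempty idfun) [::] (gempty_finite idfun)
    (@gempty_no_isolated X X idfun).

Lemma perf_mulA (X : Type) (a b c : perf_sort X) :
  perf_mul a (perf_mul b c) = perf_mul (perf_mul a b) c.
Proof.
by apply: perf_eq => /=; rewrite ?catA // gtranslateU gtranslateM gunionA.
Qed.

Lemma perf_plus_mul (X : Type) (a : perf_sort X) : perf_mul (perf_plus a) a = a.
Proof. by apply: perf_eq => //=; rewrite gtranslate_nil gunionid. Qed.

Lemma perf_plusC (X : Type) (a b : perf_sort X) :
  perf_mul (perf_plus a) (perf_plus b) = perf_mul (perf_plus b) (perf_plus a).
Proof. by apply: perf_eq => //=; rewrite !gtranslate_nil gunionC. Qed.

Lemma perf_plus_plusM (X : Type) (a b : perf_sort X) :
  perf_plus (perf_mul (perf_plus a) b) = perf_mul (perf_plus a) (perf_plus b).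
Proof. exact: perf_eq. Qed.

Lemma perf_mul_plus (X : Type) (a b : perf_sort X) :
  perf_mul a (perf_plus b) = perf_mul (perf_plus (perf_mul a b)) a.
Proof.
apply: perf_eq => /=; last exact: cats0.
by rewrite gtranslate_nil (gunionC (perf_graph a)) -gunionA gunionid.
Qed.

Definition perf_rs (X : Type) : restrictionSemigroup :=
  @RestrictionSemigroup (perf_sort X) (@perf_mul X) (@perf_plus X)
    (@perf_mulA X) (@perf_plus_mul X) (@perf_plusC X) (@perf_plus_plusM X)
    (@perf_mul_plus X).

Lemma perf_plus_max (X : Type) (a : perf_rs X) :
  a = rmul (rplus a) (perf_max a : perf_rs X).
Proof. by apply: perf_eq => //=; rewrite gtranslate0 gunion0. Qed.

Lemma perf_maxP (X : Type) (a : perf_rs X) : is_sigma_max a (perf_max a : perf_rs X).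
Proof.
split.
  exists (rplus a); first by exists a.
  by rewrite -perf_plus_max; exact: rplus_mul.
move=> b [_ [c ->] /(congr1 (@perf_elt X)) /= ab]; exists (rplus b).
  by exists b.
by rewrite {1}[b]perf_plus_max; congr rmul; exact: perf_eq.
Qed.

Lemma perf_one_proj (X : Type) : projection (perf_one X : perf_rs X).
Proof. by exists (perf_one X); exact: perf_eq. Qed.

Lemma perf_one_max (X : Type) (e : perf_rs X) :
  projection e -> nle e (perf_one X : perf_rs X).
Proof.
move=> [s ->]; exists (rplus s); first by exists s.
by apply: perf_eq => //=; rewrite gtranslate0 gunion0.
Qed.

Lemma perf_maxM (X : Type) (a b : perf_rs X) :
  rmul (perf_max a : perf_rs X) (perf_max b : perf_rs X) = perf_max (rmul a b).
Proof. by apply: perf_eq => //=; rewrite gtranslate0 gunion0. Qed.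

Lemma perf_max_plus (X : Type) (a : perf_rs X) :
  rplus (perf_max a : perf_rs X) = perf_one X.
Proof. exact: perf_eq. Qed.

Definition Perf (X : Type) : perfectFRestriction :=
  @PerfectFRestriction (perf_rs X) (@perf_max X) (perf_one X)
    (@perf_maxP X) (@perf_one_proj X) (@perf_one_max X) (@perf_maxM X)
    (@perf_max_plus X).

Definition Perf_gen (X : Type) (x : X) : Perf X :=
  @PerfElt X (gletter idfun x) [:: x] (gletter_finite idfun x)
    (@gletter_no_isolated X X idfun x).

Definition canonical_quotient (X : Type) (q : MX X -> FFRp X) : Prop :=
  [/\ [/\ forall a b, q (rmul a b) = rmul (q a) (q b),
          forall a, q (rplus a) = rplus (q a) &
          q (MX_one X) = pone],
      forall x, q (MX_gen (inl x)) = FFRp_gen x,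
      forall x, q (MX_gen (inr x)) = pmax (FFRp_gen x) &
      forall b, exists a, q a = b].

(* Existence: (A, s) is sent to the product of the projections (w^m x)^+ over the
   edges (w, x, wx) of A with x in X, multiplied by s^m. *)

Definition max_word (X : Type) (F : perfectFRestriction) (f : X -> F) (w : seq X) : F :=
  foldr (fun x a => rmul (pmax (f x)) a) pone w.

Definition edge_proj (X : Type) (F : perfectFRestriction) (f : X -> F)
  (e : seq X * X) : F := rplus (rmul (max_word f e.1) (f e.2)).

Definition edges_proj (X : Type) (F : perfectFRestriction) (f : X -> F)
  (l : seq (seq X * X)) : F := foldr (fun e a => rmul (edge_proj f e) a) pone l.

Lemma max_word_cat (X : Type) (F : perfectFRestriction) (f : X -> F) u v :
  max_word f (u ++ v) = rmul (max_word f u) (max_word f v).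
Proof. by elim: u => [|x u IH] /=; rewrite ?pmul1 // IH rmulA. Qed.

Lemma max_word_max (X : Type) (F : perfectFRestriction) (f : X -> F) u :
  pmax (max_word f u) = max_word f u.
Proof.
elim: u => [|x u IH] /=; first exact: pmax1.
rewrite -pmaxM IH; congr rmul; apply/esym/pmax_eq; exact: (pmaxP _).1.
Qed.

Lemma edge_projP (X : Type) (F : perfectFRestriction) (f : X -> F) e :
  projection (edge_proj f e).
Proof. by eexists. Qed.

Lemma edges_projP (X : Type) (F : perfectFRestriction) (f : X -> F) l :
  projection (edges_proj f l).
Proof.
elim: l => [|e l IH] /=; first exact: pone_projection.
by apply: projM IH; exact: edge_projP.
Qed.

Lemma edges_proj_mem (X : Type) (F : perfectFRestriction) (f : X -> F)
    (l : seq {classic (seq X * X)}) (e : {classic (seq X * X)}) :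
  e \in l -> rmul (edge_proj f e) (edges_proj f l) = edges_proj f l.
Proof.
elim: l => [//|e' l IH]; rewrite inE => /orP[/eqP ->|/IH {}IH] /=; rewrite rmulA.
  by rewrite (proj_idem (edge_projP _ _)).
by rewrite (projC (edge_projP _ _) (edge_projP _ _)) -rmulA IH.
Qed.

Lemma edges_proj_sub (X : Type) (F : perfectFRestriction) (f : X -> F)
    (l l' : seq {classic (seq X * X)}) :
  {subset l <= l'} -> rmul (edges_proj f l) (edges_proj f l') = edges_proj f l'.
Proof.
elim: l => [|e l IH] sub /=; first exact: pmul1.
rewrite -rmulA IH; last by move=> e' le'; apply: sub; rewrite inE le' orbT.
by apply: edges_proj_mem; apply: sub; rewrite inE eqxx.
Qed.

Lemma edges_proj_eq (X : Type) (F : perfectFRestriction) (f : X -> F)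
    (l l' : seq {classic (seq X * X)}) :
  l =i l' -> edges_proj f l = edges_proj f l'.
Proof.
move=> ll'; rewrite -(@edges_proj_sub _ _ f l' l) => [|e]; last by rewrite ll'.
rewrite (projC (edges_projP _ _) (edges_projP _ _)).
by apply: edges_proj_sub => e; rewrite ll'.
Qed.

Lemma edges_proj_cat (X : Type) (F : perfectFRestriction) (f : X -> F) l l' :
  edges_proj f (l ++ l') = rmul (edges_proj f l) (edges_proj f l').
Proof. by elim: l => [|e l IH] /=; rewrite ?pmul1 // IH rmulA. Qed.

Lemma max_word_edges (X : Type) (F : perfectFRestriction) (f : X -> F) s l :
  rmul (max_word f s) (edges_proj f l) =
  rmul (edges_proj f [seq (s ++ e.1, e.2) | e <- l]) (max_word f s).
Proof.
elim: l => [|e l IH] /=; first by rewrite pmulr1 pmul1.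
rewrite rmulA rmul_plus -!rmulA IH /edge_proj /= max_word_cat !rmulA.
by [].
Qed.

Definition edge_list (X : Type) (A : subgraph (@unbar X)) (l : seq (seq X * X)) :=
  edge (tilde A) = [set` (l : seq {classic (seq X * X)})].

Lemma edge_list_ex (X : Type) (A : subgraph (@unbar X)) :
  finite_subgraph A -> exists l, edge_list A l.
Proof.
by move=> /tilde_edge_finite /(@finite_seqP {classic (seq X * X)}).
Qed.

Lemma edge_listP (X : Type) (A : subgraph (@unbar X)) l e :
  edge_list A l -> (edge A (e.1, inl e.2) <-> e \in (l : seq {classic (seq X * X)})).
Proof. by rewrite /edge_list => /seteqP[h1 h2]; split; [exact: h1|exact: h2]. Qed.

Lemma edge_list_proj (X : Type) (F : perfectFRestriction) (f : X -> F)
    (A : subgraph (@unbar X)) l l' :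
  edge_list A l -> edge_list A l' -> edges_proj f l = edges_proj f l'.
Proof.
move=> h h'; apply: edges_proj_eq => e.
by apply/idP/idP => [/(edge_listP e h) /(edge_listP e h')
                    |/(edge_listP e h') /(edge_listP e h)].
Qed.

Definition M_edges (X : Type) (a : MX X) : seq (seq X * X) :=
  sval (cid (edge_list_ex (mm_finite a))).

Lemma M_edgesP (X : Type) (a : MX X) : edge_list (mm_graph a) (M_edges a).
Proof. exact: (svalP (cid (edge_list_ex (mm_finite a)))). Qed.

Definition M_to_F (X : Type) (F : perfectFRestriction) (f : X -> F) (a : MX X) : F :=
  rmul (edges_proj f (M_edges a)) (max_word f (mm_end a)).

Lemma M_to_FE (X : Type) (F : perfectFRestriction) (f : X -> F) (a : MX X) l :
  edge_list (mm_graph a) l ->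
  M_to_F f a = rmul (edges_proj f l) (max_word f (mm_end a)).
Proof. by move=> al; rewrite /M_to_F (edge_list_proj f (M_edgesP a) al). Qed.

Lemma edge_list_nil (X : Type) (A : subgraph (@unbar X)) :
  (forall w x, ~ edge A (w, inl x)) -> edge_list A [::].
Proof. by move=> nA; apply/seteqP; split=> [[w x] /nA|]. Qed.

Lemma edge_listM (X : Type) (a b : MX X) la lb :
  edge_list (mm_graph a) la -> edge_list (mm_graph b) lb ->
  edge_list (mm_graph (rmul a b))
    (la ++ [seq (mm_end a ++ e.1, e.2) | e <- lb]).
Proof.
move=> ha hb; apply/seteqP; split=> [[w x] /=|[w x] /=].
  case=> [/(edge_listP (w, x) ha) h|[[v y] /= Bv [<- ey]]].
    by rewrite mem_cat h.
  rewrite mem_cat; apply/orP; right; apply/(@mapP {classic _} {classic _}).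
  exists (v, x) => //; apply/(edge_listP (v, x) hb); by rewrite /= -ey.
rewrite mem_cat => /orP[/(edge_listP (w, x) ha) h|]; first by left.
case/(@mapP {classic _} {classic _}) => -[v y] /(edge_listP (v, y) hb) h [-> ->].
by right; exists (v, inl y).
Qed.

Lemma M_to_FM (X : Type) (F : perfectFRestriction) (f : X -> F) (a b : MX X) :
  M_to_F f (rmul a b) = rmul (M_to_F f a) (M_to_F f b).
Proof.
rewrite (M_to_FE f (edge_listM (M_edgesP a) (M_edgesP b))) /M_to_F.
by rewrite edges_proj_cat max_word_cat -!rmulA; congr rmul;
  rewrite !rmulA max_word_edges.
Qed.

Lemma M_to_F_plus (X : Type) (F : perfectFRestriction) (f : X -> F) (a : MX X) :
  M_to_F f (rplus a) = rplus (M_to_F f a).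
Proof.
rewrite (@M_to_FE _ _ _ (rplus a) _ (M_edgesP a)) /M_to_F /=.
by rewrite (proj_plusM _ (edges_projP f _)) -max_word_max pmax_plus.
Qed.

Lemma M_to_F_one (X : Type) (F : perfectFRestriction) (f : X -> F) :
  M_to_F f (MX_one X) = pone.
Proof.
have h : edge_list (mm_graph (MX_one X)) [::] by apply: edge_list_nil => w y [].
by rewrite (M_to_FE f h) pmul1.
Qed.

Lemma M_to_F_inl (X : Type) (F : perfectFRestriction) (f : X -> F) x :
  M_to_F f (MX_gen (inl x)) = f x.
Proof.
rewrite (@M_to_FE _ _ _ _ [:: ([::], x)]) /= /edge_proj /=.
  by rewrite !pmulr1 pmul1 plus_max.
apply/seteqP; split=> -[w y] /=; first by case=> -> ->; rewrite inE.
by rewrite inE => /eqP[-> ->].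
Qed.

Lemma M_to_F_inr (X : Type) (F : perfectFRestriction) (f : X -> F) x :
  M_to_F f (MX_gen (inr x)) = pmax (f x).
Proof.
have h : edge_list (mm_graph (MX_gen (inr x))) [::].
  by apply: edge_list_nil => w y [].
by rewrite (M_to_FE f h) pmul1 /= pmulr1.
Qed.

Lemma M_to_F_max (X : Type) (F : perfectFRestriction) (f : X -> F) s :
  exists a : MX X, M_to_F f a = max_word f s.
Proof.
elim: s => [|x s [a qa]]; first by exists (MX_one X); exact: M_to_F_one.
by exists (rmul (MX_gen (inr x)) a); rewrite M_to_FM M_to_F_inr qa.
Qed.

Lemma canonical_quotient_ex (X : Type) :
  exists q : MX X -> FFRp X, canonical_quotient q.
Proof.
pose q := M_to_F (@FFRp_gen X); exists q; split=> [|x|x|].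
- by split; [exact: M_to_FM|exact: M_to_F_plus|exact: M_to_F_one].
- exact: M_to_F_inl.
- exact: M_to_F_inr.
elim/tcls_ind; elim=> [x|t [a qa] u [b qb]|t [a qa]|t [a qa]|].
- by exists (MX_gen (inl x)); exact: M_to_F_inl.
- by exists (rmul a b); rewrite /q M_to_FM -/q qa qb; exact: fr_mulE.
- by exists (rplus a); rewrite /q M_to_F_plus -/q qa; exact: fr_plusE.
- have [b qb] := M_to_F_max (@FFRp_gen X) (mm_end a); exists b.
  rewrite /q qb -max_word_max -(pmax_projM _ (edges_projP (@FFRp_gen X) (M_edges a))).
  by rewrite -/(M_to_F _ a) -/q qa; exact: free_maxE.
- by exists (MX_one X); exact: M_to_F_one.
Qed.

(* The elements [MX_gen y] generate [MX X] as a restriction monoid, so [quotient_map]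
   is the only map satisfying [canonical_quotient]. *)
Definition quotient_map (X : Type) : MX X -> FFRp X :=
  sval (cid (canonical_quotient_ex X)).

Lemma quotient_mapP (X : Type) : canonical_quotient (@quotient_map X).
Proof. exact: (svalP (cid (canonical_quotient_ex X))). Qed.

Record congruence (R : restrictionSemigroup) (r : R -> R -> Prop) : Prop :=
  Congruence {
    cong_equiv : equivalence_on r;
    cong_mul : forall a b c d, r a b -> r c d -> r (rmul a c) (rmul b d);
    cong_plus : forall a b, r a b -> r (rplus a) (rplus b) }.

Definition rq_sort (R : restrictionSemigroup) (r : R -> R -> Prop)
  (C : congruence r) : Type := quot (cong_equiv C).

Definition rq_cls (R : restrictionSemigroup) (r : R -> R -> Prop)
  (C : congruence r) (a : R) : rq_sort C := cls (cong_equiv C) a.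

Definition rq_mul (R : restrictionSemigroup) (r : R -> R -> Prop)
  (C : congruence r) (a b : rq_sort C) : rq_sort C :=
  rq_cls C (rmul (rep a) (rep b)).

Definition rq_plus (R : restrictionSemigroup) (r : R -> R -> Prop)
  (C : congruence r) (a : rq_sort C) : rq_sort C := rq_cls C (rplus (rep a)).

Lemma rq_ind (R : restrictionSemigroup) (r : R -> R -> Prop) (C : congruence r)
    (P : rq_sort C -> Prop) :
  (forall a, P (rq_cls C a)) -> forall a, P a.
Proof. by move=> Pa a; rewrite -(repK a); exact: Pa. Qed.

Lemma rq_mulE (R : restrictionSemigroup) (r : R -> R -> Prop) (C : congruence r) a b :
  rq_mul (rq_cls C a) (rq_cls C b) = rq_cls C (rmul a b).
Proof. by apply/clsP/(cong_mul C); exact: rep_cls. Qed.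

Lemma rq_plusE (R : restrictionSemigroup) (r : R -> R -> Prop) (C : congruence r) a :
  rq_plus (rq_cls C a) = rq_cls C (rplus a).
Proof. by apply/clsP/(cong_plus C); exact: rep_cls. Qed.

Lemma rq_mulA (R : restrictionSemigroup) (r : R -> R -> Prop) (C : congruence r)
    (x y z : rq_sort C) : rq_mul x (rq_mul y z) = rq_mul (rq_mul x y) z.
Proof.
elim/rq_ind: x => a; elim/rq_ind: y => b; elim/rq_ind: z => c.
by rewrite (rq_mulE C b c) (rq_mulE C a b) !rq_mulE rmulA.
Qed.

Lemma rq_plus_mul (R : restrictionSemigroup) (r : R -> R -> Prop) (C : congruence r)
    (x : rq_sort C) : rq_mul (rq_plus x) x = x.
Proof. by elim/rq_ind: x => a; rewrite rq_plusE rq_mulE rplus_mul. Qed.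

Lemma rq_plusC (R : restrictionSemigroup) (r : R -> R -> Prop) (C : congruence r)
    (x y : rq_sort C) :
  rq_mul (rq_plus x) (rq_plus y) = rq_mul (rq_plus y) (rq_plus x).
Proof.
elim/rq_ind: x => a; elim/rq_ind: y => b.
by rewrite (rq_plusE C a) (rq_plusE C b) !rq_mulE rplusC.
Qed.

Lemma rq_plus_plusM (R : restrictionSemigroup) (r : R -> R -> Prop)
    (C : congruence r) (x y : rq_sort C) :
  rq_plus (rq_mul (rq_plus x) y) = rq_mul (rq_plus x) (rq_plus y).
Proof.
elim/rq_ind: x => a; elim/rq_ind: y => b.
rewrite (rq_plusE C a) (rq_plusE C b) (rq_mulE C (rplus a) b).
by rewrite (rq_plusE C (rmul _ _)) rq_mulE rplus_plusM.
Qed.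

Lemma rq_mul_plus (R : restrictionSemigroup) (r : R -> R -> Prop)
    (C : congruence r) (x y : rq_sort C) :
  rq_mul x (rq_plus y) = rq_mul (rq_plus (rq_mul x y)) x.
Proof.
elim/rq_ind: x => a; elim/rq_ind: y => b.
rewrite (rq_plusE C b) (rq_mulE C a b) (rq_plusE C (rmul a b)).
by rewrite !rq_mulE rmul_plus.
Qed.

Definition rq_rs (R : restrictionSemigroup) (r : R -> R -> Prop)
  (C : congruence r) : restrictionSemigroup :=
  @RestrictionSemigroup (rq_sort C) (@rq_mul R r C) (@rq_plus R r C)
    (@rq_mulA R r C) (@rq_plus_mul R r C) (@rq_plusC R r C)
    (@rq_plus_plusM R r C) (@rq_mul_plus R r C).

Definition rho_p (X : Type) (a b : MX X) : Prop := quotient_map a = quotient_map b.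

Lemma rho_p_congruence (X : Type) : congruence (@rho_p X).
Proof.
have [[qM qp _] _ _ _] := quotient_mapP X; split.
- by split=> // a b c ab; exact: etrans.
- by move=> a b c d ab cd; rewrite /rho_p !qM ab cd.
- by move=> a b ab; rewrite /rho_p !qp ab.
Qed.

Definition Mrho_rs (X : Type) : restrictionSemigroup := rq_rs (rho_p_congruence X).

Definition rho_class (X : Type) (a : MX X) : Mrho_rs X :=
  rq_cls (rho_p_congruence X) a.

Definition Mrho_bar (X : Type) (c : Mrho_rs X) : FFRp X := quotient_map (rep c).

Lemma Mrho_barE (X : Type) (a : MX X) : Mrho_bar (rho_class a) = quotient_map a.
Proof. exact: (rep_cls (cong_equiv (rho_p_congruence X))). Qed.

Lemma Mrho_bar_inj (X : Type) : injective (@Mrho_bar X).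
Proof. by move=> c d cd; rewrite -(repK c) -(repK d); apply/clsP. Qed.

Lemma Mrho_bar_surj (X : Type) (b : FFRp X) : exists c, Mrho_bar c = b.
Proof.
have [_ _ _ /(_ b)[a <-]] := quotient_mapP X.
by exists (rho_class a); exact: Mrho_barE.
Qed.

Lemma Mrho_barM (X : Type) (c d : Mrho_rs X) :
  Mrho_bar (rmul c d) = rmul (Mrho_bar c) (Mrho_bar d).
Proof. by have [[qM _ _] _ _ _] := quotient_mapP X; rewrite [LHS]Mrho_barE qM. Qed.

Lemma Mrho_bar_plus (X : Type) (c : Mrho_rs X) :
  Mrho_bar (rplus c) = rplus (Mrho_bar c).
Proof. by have [[_ qp _] _ _ _] := quotient_mapP X; rewrite [LHS]Mrho_barE qp. Qed.

Lemma Mrho_bar_proj (X : Type) (c : Mrho_rs X) :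
  projection (Mrho_bar c) <-> projection c.
Proof.
split=> [[s cs]|[s ->]]; last by exists (Mrho_bar s); exact: Mrho_bar_plus.
have [d ds] := Mrho_bar_surj s; exists d; apply: Mrho_bar_inj.
by rewrite Mrho_bar_plus ds.
Qed.

Lemma Mrho_bar_sigma (X : Type) (c d : Mrho_rs X) :
  sigma (Mrho_bar c) (Mrho_bar d) <-> sigma c d.
Proof.
split=> -[e pe ecd]; last first.
  by exists (Mrho_bar e); [exact/Mrho_bar_proj|rewrite -!Mrho_barM ecd].
have [e' ee'] := Mrho_bar_surj e; exists e'.
  by apply/Mrho_bar_proj; rewrite ee'.
by apply: Mrho_bar_inj; rewrite !Mrho_barM ee'.
Qed.

Lemma Mrho_bar_nle (X : Type) (c d : Mrho_rs X) :
  nle (Mrho_bar c) (Mrho_bar d) <-> nle c d.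
Proof.
split=> -[e pe ecd]; last first.
  by exists (Mrho_bar e); [exact/Mrho_bar_proj|rewrite -Mrho_barM -ecd].
have [e' ee'] := Mrho_bar_surj e; exists e'.
  by apply/Mrho_bar_proj; rewrite ee'.
by apply: Mrho_bar_inj; rewrite Mrho_barM ee'.
Qed.

Lemma Mrho_max_spec (X : Type) (c m : Mrho_rs X) :
  Mrho_bar m = pmax (Mrho_bar c) -> is_sigma_max c m.
Proof.
have [cm cM] := pmaxP (Mrho_bar c) => em; split=> [|d /Mrho_bar_sigma cd].
  by apply/Mrho_bar_sigma; rewrite em.
by apply/Mrho_bar_nle; rewrite em; exact: cM.
Qed.

Lemma Mrho_max_ex (X : Type) (c : Mrho_rs X) : exists m, is_sigma_max c m.
Proof.
by have [m /Mrho_max_spec] := Mrho_bar_surj (pmax (Mrho_bar c)); exists m.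
Qed.

(* The operation m of the quotient is the one determined by its order. *)
Definition Mrho_max (X : Type) (c : Mrho_rs X) : Mrho_rs X :=
  sval (cid (Mrho_max_ex c)).

Lemma Mrho_maxP (X : Type) (c : Mrho_rs X) : is_sigma_max c (Mrho_max c).
Proof. exact: (svalP (cid (Mrho_max_ex c))). Qed.

Lemma Mrho_bar_max (X : Type) (c : Mrho_rs X) :
  Mrho_bar (Mrho_max c) = pmax (Mrho_bar c).
Proof.
have [m em] := Mrho_bar_surj (pmax (Mrho_bar c)); rewrite -em; congr Mrho_bar.
have [cm cM] := Mrho_max_spec em; have [cm' cM'] := Mrho_maxP c.
by apply: nle_antisym; [exact: cM|exact: cM'].
Qed.

Definition Mrho_one (X : Type) : Mrho_rs X := rho_class (MX_one X).

Lemma Mrho_bar_one (X : Type) : Mrho_bar (Mrho_one X) = pone.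
Proof. by have [[_ _ q1] _ _ _] := quotient_mapP X; rewrite Mrho_barE. Qed.

Lemma Mrho_one_proj (X : Type) : projection (Mrho_one X).
Proof. by apply/Mrho_bar_proj; rewrite Mrho_bar_one; exact: pone_proj. Qed.

Lemma Mrho_one_max (X : Type) (e : Mrho_rs X) : projection e -> nle e (Mrho_one X).
Proof.
by move=> /Mrho_bar_proj pe; apply/Mrho_bar_nle; rewrite Mrho_bar_one; exact: pone_max.
Qed.

Lemma Mrho_maxM (X : Type) (c d : Mrho_rs X) :
  rmul (Mrho_max c) (Mrho_max d) = Mrho_max (rmul c d).
Proof.
by apply: Mrho_bar_inj; rewrite Mrho_barM !Mrho_bar_max Mrho_barM pmaxM.
Qed.

Lemma Mrho_max_plus (X : Type) (c : Mrho_rs X) : rplus (Mrho_max c) = Mrho_one X.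
Proof.
by apply: Mrho_bar_inj; rewrite Mrho_bar_plus Mrho_bar_max pmax_plus Mrho_bar_one.
Qed.

Definition Mrho (X : Type) : perfectFRestriction :=
  @PerfectFRestriction (Mrho_rs X) (@Mrho_max X) (Mrho_one X)
    (@Mrho_maxP X) (@Mrho_one_proj X) (@Mrho_one_max X) (@Mrho_maxM X)
    (@Mrho_max_plus X).

Definition Mrho_gen (X : Type) (x : X) : Mrho X := rho_class (MX_gen (inl x)).

(* Main.v *)
Require Import Defs.
From mathcomp Require Import all_boot.
From mathcomp Require Import boolp classical_sets functions cardinality.

Set Implicit Arguments.
Unset Strict Implicit.
Unset Printing Implicit Defensive.

Local Open Scope classical_set_scope.

(** Let [h : FFRp X -> Perf X] be the morphism given by freeness.  The theorem
    reduces to the bijectivity of [h]: the map of the statement is [h] composed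
    with the isomorphism [Mrho_bar] from [Mrho X] to [FFRp X], and the second
    isomorphism is the inverse of [h].

    Call normal form a product of projections [(w^m x)^+], one for each edge
    [(w, x)] of a finite list, followed by [s^m]; here [w^m] is the product of
    the [x^m] over the letters [x] of [w].  Since projections commute and are
    idempotent, its value in any perfect F-restriction monoid depends only
    on the set of listed edges and on [s] ([edges_proj_eq]).  In [Perf X] the
    normal form evaluates to the pair of the graph with exactly these edges and
    of [s] ([edge_normal_form_Perf], [elt_normal_form_Perf]); as the graphs in [Perf X]
    have no isolated vertices, they are determined by their edges, so each
    element of [Perf X] has exactly one normal form up to the order and
    repetition of the edges.  Every element of [FFRp X] also has a normal form,
    and [h] preserves normal forms, whence [h] is bijective ([free_to_Perf_inj],
    [free_to_Perf_surj]).

    It remains to see that the canonical quotient morphism sends [(A, s)] to the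
    normal form on the edges of [A] labelled in [X] and the word [s]
    ([quotient_mapE]), so that [h] sends it to [(tilde A, s)].  Two morphisms of
    restriction monoids that agree on the letters agree everywhere because the
    letters generate [M^lambda] ([mm_ind]); this is where accessibility of the
    graphs is essential. *)

(** * The letters generate the monoid of finite accessible graphs *)

Definition gsub (X Y : Type) (lab : Y -> X) (A B : subgraph lab) : Prop :=
  vertex A `<=` vertex B /\ edge A `<=` edge B.

Lemma gunion_sub (X Y : Type) (lab : Y -> X) (A B C : subgraph lab) :
  gsub A C -> gsub B C -> gsub (gunion A B) C.
Proof.
by move=> [AvC AeC] [BvC BeC]; split=> x [];
  [exact: AvC|exact: BvC|exact: AeC|exact: BeC].
Qed.

Lemma gunion_sub_eq (X Y : Type) (lab : Y -> X) (A B : subgraph lab) :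
  gsub B A -> gunion A B = A.
Proof. by move=> [BvA BeA]; apply: subgraph_eq; exact/setUidPl. Qed.

Lemma gpoint_sub (X Y : Type) (lab : Y -> X) (A : subgraph lab) :
  vertex A [::] -> gsub (gpoint lab) A.
Proof. by move=> A0; split=> [_ ->|]. Qed.

Lemma gletter_translate_sub (X Y : Type) (lab : Y -> X) (A : subgraph lab) w y :
  edge A (w, y) -> gsub (gtranslate w (gletter lab y)) A.
Proof.
move=> Awy; split=> [_ [v [->|->] <-]|_ [e -> <-]] /=; rewrite ?cats0 //.
  exact: edge_src Awy.
by rewrite cats1; exact: edge_tgt Awy.
Qed.

Lemma accessible_target (X Y : Type) (lab : Y -> X) (A : subgraph lab) v :
  accessible A -> vertex A v ->
  v = [::] \/ exists w y, edge A (w, y) /\ v = rcons w (lab y).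
Proof.
by move=> [_ Ar] /Ar[|w y _ Awy]; [left|right; exists w, y].
Qed.

(** Walking along a path of [A] from the root and multiplying the letters met
    gives elements with graph inside [A]: an element ending at any prescribed
    vertex, and, after applying [+], a projection containing any prescribed
    edge.  The product of these projections over all edges of [A] is the
    projection with graph [A], accessibility ensuring that no vertex is missed. *)
Lemma mm_ind (X Y : Type) (lab : Y -> X) (P : mm_rs lab -> Prop) :
  P (mm_one lab) -> (forall y, P (mm_gen lab y)) ->
  (forall a b : mm_rs lab, P a -> P b -> P (rmul a b)) ->
  (forall a : mm_rs lab, P a -> P (rplus a)) ->
  forall a, P a.
Proof.
move=> P1 Pgen PM Pplus [A s Afin Aacc As].
have [A0 Areach] := Aacc.
have path v : vertex A v ->
    exists c : mm_rs lab, [/\ P c, gsub (mm_graph c) A & mm_end c = v].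
  move=> /Areach; elim=> [|w y _ [c [Pc cA cw]] Awy].
    by exists (mm_one lab); split=> //; exact: gpoint_sub.
  exists (rmul c (mm_gen lab y)); split; first by apply: PM.
    by apply: gunion_sub => //; rewrite cw; exact: gletter_translate_sub.
  by rewrite /= cw cats1.
have proj (l : seq {classic (seq X * Y)}) : (forall e, e \in l -> edge A e) ->
    exists p : mm_rs lab, [/\ P p, gsub (mm_graph p) A, mm_end p = [::] &
      forall e, e \in l -> edge (mm_graph p) e].
  elim: l => [|[w y] l IH] lA.
    by exists (mm_one lab); split=> //; exact: gpoint_sub.
  have [|p [Pp pA p0 lp]] := IH.
    by move=> e el; apply: lA; rewrite inE el orbT.
  have Awy : edge A (w, y) by apply: lA; rewrite inE eqxx.
  have [c [Pc cA cw]] := path _ (edge_src Awy).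
  exists (rmul (rplus (rmul c (mm_gen lab y))) p); split.
  - by apply: (PM _ _ _ Pp); apply/Pplus/PM.
  - apply: gunion_sub; last by rewrite /= gtranslate_nil.
    by apply: gunion_sub => //; rewrite cw; exact: gletter_translate_sub.
  - exact: p0.
  - move=> e; rewrite [mm_graph _]/= gtranslate_nil inE => /orP[/eqP->|/lp pe].
      by left; right; exists ([::], y); rewrite //= cw cats0.
    by right.
have [l Al] := (@finite_seqP {classic _} _).1 Afin.2.
have [e|p [Pp pA p0 lp]] := proj l; first by rewrite Al.
have pE : mm_graph p = A.
  have Ep : edge A `<=` edge (mm_graph p) by rewrite Al => e; exact: lp.
  apply: subgraph_eq; apply/seteqP; split=> //; try exact: pA.1; try exact: pA.2.
  move=> v /(accessible_target Aacc)[->|[w [y [/Ep pwy ->]]]].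
    exact: (mm_accessible p).1.
  exact: edge_tgt pwy.
have [c [Pc cA cs]] := path s As.
suff -> : MMElt Afin Aacc As = rmul p c by exact: PM.
by apply: mm_eq; rewrite /= p0 ?cs // gtranslate_nil pE gunion_sub_eq.
Qed.

(** The canonical quotient morphism is only known through its values on the
    letters; generation by the letters makes it the explicit product over edges. *)
Lemma quotient_mapE (X : Type) (a : MX X) :
  quotient_map a = M_to_F (@FFRp_gen X) a.
Proof.
have [[qM qp q1] qx qbx _] := quotient_mapP X.
elim/mm_ind: a => [|[x|x]|a b qa qb|a qa].
- by rewrite q1 M_to_F_one.
- by rewrite qx M_to_F_inl.
- by rewrite qbx M_to_F_inr.
- by rewrite qM M_to_FM qa qb.
- by rewrite qp M_to_F_plus qa.
Qed.

(** * Normal forms *)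

Definition normal_form (X : Type) (F : perfectFRestriction) (f : X -> F)
  (l : seq (seq X * X)) (s : seq X) : F := rmul (edges_proj f l) (max_word f s).

Lemma morphism_max_word (X : Type) (F G : perfectFRestriction) (f : X -> F)
    (h : F -> G) s :
  pf_morphism h -> h (max_word f s) = max_word (h \o f) s.
Proof. by move=> [hM _ hm h1]; elim: s => //= x s IH; rewrite hM hm IH. Qed.

Lemma morphism_normal_form (X : Type) (F G : perfectFRestriction) (f : X -> F)
    (h : F -> G) l s :
  pf_morphism h -> h (normal_form f l s) = normal_form (h \o f) l s.
Proof.
move=> hmor; have [hM hp _ h1] := hmor.
rewrite /normal_form hM morphism_max_word //; congr rmul.
by elim: l => //= e l IH; rewrite hM IH /edge_proj hp hM morphism_max_word.
Qed.

Lemma max_word_Perf (X : Type) (s : seq X) :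
  perf_graph (max_word (@Perf_gen X) s) = gempty idfun /\
  perf_elt (max_word (@Perf_gen X) s) = s.
Proof.
by elim: s => //= x s [-> ->]; rewrite gtranslate0 gunion0.
Qed.

Lemma elt_edges_Perf (X : Type) (l : seq (seq X * X)) :
  perf_elt (edges_proj (@Perf_gen X) l) = [::].
Proof. by elim: l. Qed.

(** In [Perf X] the projection [(w^m x)^+] is the single edge labelled [x] at
    [w], and projections multiply by uniting their graphs. *)
Lemma edge_edges_Perf (X : Type) (l : seq {classic (seq X * X)}) :
  edge (perf_graph (edges_proj (@Perf_gen X) l)) = [set` l].
Proof.
elim: l => [|[w x] l IH].
  by apply/seteqP; split.
have -> : perf_graph (edges_proj (@Perf_gen X) ((w, x) :: l)) =
    gunion (gtranslate w (gletter idfun x)) (perf_graph (edges_proj (@Perf_gen X) l)).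
  rewrite [LHS]/= gtranslate_nil; have [-> ->] := max_word_Perf w.
  by congr gunion; rewrite gunionC gunion0.
rewrite /= IH image_set1 /= cats0.
by apply/seteqP; split=> e; rewrite /= inE; [move=> h; apply/predU1P|move/predU1P].
Qed.

Lemma elt_normal_form_Perf (X : Type) l (s : seq X) :
  perf_elt (normal_form (@Perf_gen X) l s) = s.
Proof. by rewrite /= elt_edges_Perf (max_word_Perf s).2. Qed.

Lemma edge_normal_form_Perf (X : Type) (l : seq {classic (seq X * X)}) (s : seq X) :
  edge (perf_graph (normal_form (@Perf_gen X) l s)) = [set` l].
Proof.
by rewrite /= elt_edges_Perf (max_word_Perf s).1 edge_edges_Perf image_set0 setU0.
Qed.

Lemma no_isolated_eq (X Y : Type) (lab : Y -> X) (A B : subgraph lab) :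
  no_isolated_vertex A -> no_isolated_vertex B -> edge A = edge B -> A = B.
Proof.
move=> Ai Bi AB; apply: subgraph_eq => //; apply/seteqP.
split=> v => [/Ai|/Bi] [w [y [e [->|->]]]].
- by apply: (@edge_src _ _ _ B w y); rewrite -AB.
- by apply: (@edge_tgt _ _ _ B w y); rewrite -AB.
- by apply: (@edge_src _ _ _ A w y); rewrite AB.
- by apply: (@edge_tgt _ _ _ A w y); rewrite AB.
Qed.

Lemma Perf_normal_formP (X : Type) (a : Perf X) :
  exists l s, a = normal_form (@Perf_gen X) l s.
Proof.
have [l al] := (@finite_seqP {classic _} _).1 (perf_finite a).2.
exists l, (perf_elt a); apply: perf_eq; last by rewrite elt_normal_form_Perf.
apply: no_isolated_eq; try exact: perf_no_isolated.
by rewrite edge_normal_form_Perf.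
Qed.

(** The canonical quotient morphism is onto and its values are normal forms. *)
Lemma FFRp_normal_formP (X : Type) (b : FFRp X) :
  exists l s, b = normal_form (@FFRp_gen X) l s.
Proof.
have [_ _ _ /(_ b)[a <-]] := quotient_mapP X.
by exists (M_edges a), (mm_end a); rewrite quotient_mapE.
Qed.

Lemma tilde_no_isolated (X : Type) (A : subgraph (@unbar X)) :
  no_isolated_vertex (tilde A).
Proof. by []. Qed.

(** * The comparison of the free object with the graph model *)

Definition canonical_morphism (X : Type) (h : FFRp X -> Perf X) : Prop :=
  pf_morphism h /\ forall x, h (FFRp_gen x) = Perf_gen x.

Lemma canonical_normal_form (X : Type) (h : FFRp X -> Perf X) l s :
  canonical_morphism h ->
  h (normal_form (@FFRp_gen X) l s) = normal_form (@Perf_gen X) l s.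
Proof.
move=> [hmor hx]; rewrite morphism_normal_form //.
by congr normal_form; apply/funext.
Qed.

Lemma free_to_Perf_surj (X : Type) (h : FFRp X -> Perf X) :
  canonical_morphism h -> forall a, exists b, h b = a.
Proof.
move=> hcan a; have [l [s ->]] := Perf_normal_formP a.
by exists (normal_form (@FFRp_gen X) l s); exact: canonical_normal_form.
Qed.

(** The word and the set of edges can be read off the image of a normal form,
    and they determine the normal form in any perfect F-restriction monoid. *)
Lemma free_to_Perf_inj (X : Type) (h : FFRp X -> Perf X) :
  canonical_morphism h -> injective h.
Proof.
move=> hcan b c; have [l [s ->]] := FFRp_normal_formP b.
have [l' [s' ->]] := FFRp_normal_formP c.
rewrite !canonical_normal_form // => e.
have := congr1 (@perf_elt X) e; rewrite !elt_normal_form_Perf => ->.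
congr rmul; apply: edges_proj_eq => u.
have := congr1 (fun a : Perf X => edge (perf_graph a) u) e.
by rewrite !edge_normal_form_Perf /= => /propeqP lu; apply/idP/idP => /lu.
Qed.

Lemma free_to_Perf_quotient (X : Type) (h : FFRp X -> Perf X) (a : MX X) :
  canonical_morphism h ->
  perf_graph (h (quotient_map a)) = tilde (mm_graph a) /\
  perf_elt (h (quotient_map a)) = mm_end a.
Proof.
move=> hcan; rewrite quotient_mapE -/(normal_form _ _ _) canonical_normal_form //.
split; last exact: elt_normal_form_Perf.
apply: no_isolated_eq; [exact: perf_no_isolated|exact: tilde_no_isolated|].
by rewrite edge_normal_form_Perf -(M_edgesP a).
Qed.

Lemma bijective_inj_surj (T U : Type) (f : T -> U) :
  injective f -> (forall u, exists t, f t = u) -> bijective f.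
Proof.
move=> finj fsurj; have fK : cancel (fun u => sval (cid (fsurj u))) f.
  by move=> u; exact: svalP (cid (fsurj u)).
by exists (fun u => sval (cid (fsurj u))) => // t; apply: finj.
Qed.

Lemma canonical_iso_inv (X : Type) (F G : perfectFRestriction)
    (i : X -> F) (j : X -> G) (f : F -> G) :
  canonical_iso i j f -> exists g, canonical_iso j i g.
Proof.
move=> [[fM fp fm f1] [g fK gK] fx]; have finj := can_inj fK.
exists g; split; [|by exists f|by move=> x; rewrite -fx].
by split=> [s t|s|s|]; apply: finj; rewrite ?fM ?fp ?fm ?f1 !gK.
Qed.

Lemma canonical_iso_comp (X : Type) (F G H : perfectFRestriction)
    (i : X -> F) (j : X -> G) (k : X -> H) (f : F -> G) (g : G -> H) :
  canonical_iso i j f -> canonical_iso j k g -> canonical_iso i k (g \o f).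
Proof.
move=> [[fM fp fm f1] fbij fx] [[gM gp gm g1] gbij gx].
split; [|exact: bij_comp|by move=> x /=; rewrite fx].
by split=> [s t|s|s|] /=; rewrite ?fM ?gM ?fp ?gp ?fm ?gm ?f1.
Qed.

Lemma Mrho_bar_iso (X : Type) :
  canonical_iso (@Mrho_gen X) (@FFRp_gen X) (@Mrho_bar X : Mrho X -> FFRp X).
Proof.
have [_ qx _ _] := quotient_mapP X; split.
- split; [exact: Mrho_barM|exact: Mrho_bar_plus|exact: Mrho_bar_max|].
  exact: Mrho_bar_one.
- apply: bijective_inj_surj; [exact: Mrho_bar_inj|exact: Mrho_bar_surj].
- by move=> x; rewrite Mrho_barE.
Qed.

Theorem theorem6p6 (X : Type) (X_ne : inhabited X) :
  (exists psi : Mrho X -> Perf X,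
     (forall a : MX X,
        perf_graph (psi (rho_class a)) = tilde (mm_graph a) /\
        perf_elt (psi (rho_class a)) = mm_end a) /\
     canonical_iso (@Mrho_gen X) (@Perf_gen X) psi) /\
  (exists theta : Perf X -> FFRp X,
     canonical_iso (@Perf_gen X) (@FFRp_gen X) theta).
Proof.
have [h [hcan _]] := FFRp_free (@Perf_gen X).
have hiso : canonical_iso (@FFRp_gen X) (@Perf_gen X) h.
  split; [exact: hcan.1| |exact: hcan.2].
  apply: bijective_inj_surj; first exact: free_to_Perf_inj.
  exact: free_to_Perf_surj.
split; last exact: canonical_iso_inv hiso.
exists (h \o @Mrho_bar X); split=> [a|].
  by rewrite /= Mrho_barE; exact: free_to_Perf_quotient.
exact: canonical_iso_comp (Mrho_bar_iso X) hiso.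
Qed.
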